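(* Let $N\in\mathbb{N}$. Then \begin{equation*} \sum_{n=1}^{N}\frac{q^n(q^{n+1};q)_{N-n}}{(q^{2n};q^2)_{N-n+1}}=\sum_{n=1}^{\infty}N_{\mathrm{SC}}(n, N)q^n. \end{equation*}
   Context: $(A;p)_0=1$, $(A;p)_n=(1-A)(1-Ap)\cdots(1-Ap^{n-1})$. For a partition $\pi$, $|\pi|$, $s(\pi)$, $l(\pi)$, $\#(\pi)$ denote its sum, smallest part, largest part and number of parts. Let $S_N$ be the set of triples $\vec\pi=(\pi_1,\pi_2,\pi_3)$ with $\pi_1$ a nonempty partition into distinct parts, $\pi_2,\pi_3$ arbitrary partitions, $s(\pi_1)\leq\min(s(\pi_2),s(\pi_3))$ (with $s$ of the empty partition taken as $\infty$), and $l(\pi_1),l(\pi_2),l(\pi_3)\leq N$; $|\vec\pi|=|\pi_1|+|\pi_2|+|\pi_3|$. A triple is self-conjugate if $\pi_2=\pi_3$. $N_{\mathrm{SC}}(n,N)$ is the sum of $(-1)^{\#(\pi_1)-1}$ over self-conjugate $\vec\pi\in S_N$ with $|\vec\pi|=n$. *)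

(* Defs.v *)
From mathcomp Require Import all_boot all_order all_algebra.
From mathcomp Require Import boolp classical_sets fsbigop.
From mathcomp Require Import reals constructive_ereal topology normedtype.
From mathcomp Require Import complex.

Set Implicit Arguments.
Unset Strict Implicit.
Unset Printing Implicit Defensive.

Import Order.TTheory GRing.Theory Num.Theory.
Import numFieldNormedType.Exports.

Local Open Scope classical_set_scope.
Local Open Scope ring_scope.

(* R[i] packaged as a numFieldType: the norm topology is inferred for the carrier
   of a numFieldType, but not for R[i] itself. *)
Definition Cplx (R : realType) : numFieldType := R[i].

(* The q-shifted factorial (A; p)_n. *)
Definition qpoch (K : pzRingType) (A p : K) (n : nat) : K :=
  \prod_(k < n) (1 - A * p ^+ k).

(* A partition is the nonincreasing list of its (positive) parts. *)
Definition is_partition (p : seq nat) : bool :=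
  sorted geq p && all (leq 1) p.

(* The value at the empty partition is +oo. *)
Definition smallest_part (p : seq nat) : \bar int :=
  \big[Order.min/+oo%E]_(i <- p) (i%:Z)%:E.

Definition largest_part (p : seq nat) : nat := \max_(i <- p) i.

Notation triple := (seq nat * seq nat * seq nat)%type.

Definition pi1 (t : triple) : seq nat := t.1.1.
Definition pi2 (t : triple) : seq nat := t.1.2.
Definition pi3 (t : triple) : seq nat := t.2.

Definition S_ (N : nat) : set triple := [set t |
  [/\ [/\ is_partition (pi1 t), is_partition (pi2 t) & is_partition (pi3 t)],
      pi1 t <> [::] /\ uniq (pi1 t),
      (smallest_part (pi1 t)
         <= Order.min (smallest_part (pi2 t)) (smallest_part (pi3 t)))%E &
      [/\ (largest_part (pi1 t) <= N)%N, (largest_part (pi2 t) <= N)%N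
        & (largest_part (pi3 t) <= N)%N]]].

Definition weight (t : triple) : nat :=
  (sumn (pi1 t) + sumn (pi2 t) + sumn (pi3 t))%N.

Definition self_conjugate (t : triple) : Prop := pi2 t = pi3 t.

(* The index set is finite, so this finitely supported sum is the actual sum. *)
Definition N_SC (n N : nat) : int :=
  \sum_(t \in [set t | [/\ S_ N t, self_conjugate t & weight t = n]])
    ((-1) ^+ (size (pi1 t)).-1 : int).

(* Main.v *)
(** Split the self-conjugate triples according to [pi1], written [rcons p n]
    with [n] its smallest part.  For fixed [n] the signed sum of
    [q^|pi1|] over the strict partitions [p] with parts in [n+1, N] is
    [q^n * (q^(n+1); q)_(N-n)],
    and the sum of [q^(2|pi2|)] over [pi2 = pi3] with parts in [n, N] is
    [1 / (q^(2n); q^2)_(N-n+1)].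

    The partial sums of the series are the sums over the triples of weight at
    most [m].  Since there are finitely many [pi1], only convergence of the sum
    of [z^|pi2|] over partitions of weight at most [m] is needed ([z = q^2]).
    Deleting one largest allowed part [k] shows that it satisfies
    [u_k(m) = u_(k-1)(m) + z^k u_k(m - k)], and [|z^k| < 1] makes such a
    recurrence pass to the limit [u_k = u_(k-1) / (1 - z^k)]. *)

Require Import Defs.
From mathcomp Require Import all_boot all_order all_algebra finmap.
From mathcomp Require Import boolp classical_sets fsbigop.
From mathcomp Require Import reals constructive_ereal topology normedtype.
From mathcomp Require Import complex.
From mathcomp Require Import functions cardinality sequences ring zify.

Import Order.TTheory GRing.Theory Num.Theory.
Import numFieldNormedType.Exports.

Local Open Scope classical_set_scope.
Local Open Scope ring_scope.

(** * Finite sums grouped by a key *)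

Lemma fsbig_partition (M : nmodType) (T K : choiceType) (A : set T)
    (key : T -> K) (r : seq K) (F : T -> M) :
  finite_set A -> uniq r -> (forall t, A t -> key t \in r) ->
  \sum_(t \in A) F t =
  \sum_(k <- r) \sum_(t \in [set t | A t /\ key t = k]) F t.
Proof.
move=> finA Ur Ar; rewrite fsbig_finite //.
transitivity (\sum_(k <- r) \sum_(t <- fset_set A | key t == k) F t); last first.
  apply: eq_bigr => k _.
  pose B := [set t | A t /\ key t = k].
  (* Extending [F] by zero outside [B] lets the sum over [B] be widened to all of [A]. *)
  rewrite (eq_fsbigr (patch (fun=> 0) B F)); last by move=> t; rewrite /patch => ->.
  rewrite (fsbig_widen B A) //; first last.
  - by move=> t /= [At nt]; rewrite /patch memNset.
  - by move=> t [].
  rewrite fsbig_finite //= big_mkcond /=; apply: eq_big_seq => t.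
  rewrite in_fset_set // inE => At; rewrite /patch.
  by case: ifPn => /eqP tk; [rewrite mem_set|rewrite memNset// => -[]].
(* After the exchange each [t] meets exactly one entry of the duplicate-free [r], namely [key t]. *)
rewrite (exchange_big_dep xpredT) //=; apply: eq_big_seq => t.
rewrite in_fset_set // inE => /Ar tr.
rewrite -big_filter (@eq_filter _ _ (pred1 (key t))); last first.
  by move=> k /=; rewrite eq_sym.
by rewrite filter_pred1_uniq // big_seq1.
Qed.

(** * Partitions with parts in an interval and bounded weight *)

Lemma geq_trans : transitive geq.
Proof. exact: rev_trans leq_trans. Qed.

Lemma gtn_trans : transitive gtn.
Proof. exact: rev_trans ltn_trans. Qed.

Definition bounded_partitions (j n m : nat) : set (seq nat) :=
  [set p | [/\ sorted geq p, all (fun x => j <= x <= n)%N p & (sumn p <= m)%N]].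

Lemma bounded_partitions_nil j n m :
  (n < j)%N -> bounded_partitions j n m = [set [::]].
Proof.
move=> nj; apply/seteqP; split => [[|x p] //= [_ /= /andP[xb _] _]|p -> //].
by exfalso; lia.
Qed.

Lemma bounded_partitions_lt j n m : (m < n.+1)%N ->
  bounded_partitions j n.+1 m = bounded_partitions j n m.
Proof.
move=> mn; apply/seteqP; split => p [sp ap wp]; split=> //; last first.
  by apply: sub_all ap => x /andP[-> /leqW].
apply/allP => x xp; have /andP[-> _] := allP ap x xp; rewrite /=.
rewrite -ltnS; apply: leq_ltn_trans mn; apply: leq_trans wp.
by rewrite (perm_sumn (perm_to_rem xp)) /= leq_addr.
Qed.

(** The list is nonincreasing, so a part [n.+1] can only occur at the head. Its removal keeps the
    bound [n.+1], because parts may repeat. *)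
Lemma bounded_partitionsS j n m : (j <= n.+1)%N -> (n < m)%N ->
  bounded_partitions j n.+1 m =
  bounded_partitions j n m `|`
  [set n.+1 :: p | p in bounded_partitions j n.+1 (m - n.+1)].
Proof.
move=> jn nm; apply/seteqP; split => [p [sp ap wp]|p []].
- case: p sp ap wp => [|x p] sp ap wp; first by left.
  move: sp ap wp => /= sp /andP[/andP[jx xn] ap] wp.
  have xp : all (geq x) p by move: sp; rewrite (path_sortedE geq_trans) => /andP[].
  have [xE|xN] := eqVneq x n.+1.
    right; exists p; last by rewrite xE.
    by split=> //; [exact: path_sorted sp|lia].
  left; split=> //=; rewrite jx /=; apply/andP; split; first by lia.
  apply/allP => y yp; have := allP ap y yp; have := allP xp y yp.
  by rewrite /geq /=; lia.
- move=> [sp ap wp]; split=> //.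
  by apply: sub_all ap => x /andP[-> /leqW].
- move=> [p' [sp ap wp] <-]; split=> /=; last by lia.
  + rewrite (path_sortedE geq_trans) sp andbT.
    by apply: sub_all ap => x /andP[].
  + by rewrite leqnn jn.
Qed.

Lemma finite_bounded_partitions j n m : (0 < j)%N ->
  finite_set (bounded_partitions j n m).
Proof.
move=> j0; elim: n m => [|n IHn] m.
  by rewrite bounded_partitions_nil //; exact: finite_set1.
have [jn|jn] := leqP j n.+1; last first.
  by rewrite bounded_partitions_nil //; exact: finite_set1.
(* Removing a part [n.+1] lowers only the weight bound, hence the inner induction on [m]. *)
elim/ltn_ind: m => m IHm; have [mn|mn] := ltnP m n.+1.
  by rewrite bounded_partitions_lt.
rewrite bounded_partitionsS // finite_setU; split=> //.
by apply: finite_image; apply: IHm; lia.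
Qed.

(** The guard [n < m] matters: for smaller [m] the truncated [m - n.+1] is 0, and the sum would
    wrongly count the empty partition. *)
Lemma sum_bounded_partitionsS (K : fieldType) (z : K) j n m :
  (0 < j)%N -> (j <= n.+1)%N ->
  \sum_(p \in bounded_partitions j n.+1 m) z ^+ sumn p =
  \sum_(p \in bounded_partitions j n m) z ^+ sumn p +
  (if (n < m)%N then
     z ^+ n.+1 *
     \sum_(p \in bounded_partitions j n.+1 (m - n.+1)) z ^+ sumn p
   else 0).
Proof.
move=> j0 jn; case: ifPn => [nm|]; last first.
  by rewrite -ltnNge addr0 => mn; rewrite bounded_partitions_lt.
rewrite bounded_partitionsS // fsbigU /=; first last.
- move=> p [[_ ap _] [p' _ pE]]; exfalso; move: ap; rewrite -pE /=; lia.
- by apply: finite_image; exact: finite_bounded_partitions.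
- exact: finite_bounded_partitions.
congr (_ + _); rewrite fsbig_image /=; last by move=> x y _ _ [].
by rewrite mulr_fsumr; apply: eq_fsbigr => p _; rewrite exprD.
Qed.

(** * Partitions into distinct parts *)

Fixpoint strict_partitions (j n : nat) : seq (seq nat) :=
  if n is n'.+1 then
    let r := strict_partitions j n' in
    if (j <= n)%N then r ++ map (cons n) r else r
  else [:: [::]].

Lemma mem_strict_partitions j n p : (0 < j)%N ->
  (p \in strict_partitions j n) =
  sorted gtn p && all (fun x => j <= x <= n)%N p.
Proof.
move=> j0; elim: n p => [|n IH] p.
  case: p => [|x p] //=; rewrite inE /=.
  by apply/esym/negbTE; rewrite !negb_and; apply/orP; right; lia.
rewrite /=; case: leqP => jn; last first.
  by rewrite IH; congr andb; apply: eq_all => x; apply/idP/idP; lia.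
rewrite mem_cat IH; apply/orP/andP => [[/andP[sp ap]|/mapP[p']]|[sp ap]].
- by split=> //; apply: sub_all ap => x /andP[-> /leqW].
- rewrite IH => /andP[sp ap] ->; split=> /=.
    rewrite (path_sortedE gtn_trans) sp andbT.
    by apply: sub_all ap => x /andP[].
  by rewrite leqnn jn /=; apply: sub_all ap => x /andP[-> /leqW].
- case: p sp ap => [|x p] sp ap; first by left.
  move: sp ap => /= sp /andP[/andP[jx xn] ap].
  have xp : all (gtn x) p by move: sp; rewrite (path_sortedE gtn_trans) => /andP[].
  have ap' : all (fun y => j <= y <= n)%N p.
    apply/allP => y yp; have := allP ap y yp; have := allP xp y yp.
    by rewrite /gtn /=; lia.
  have [xE|xN] := eqVneq x n.+1.
    right; apply/mapP; exists p; last by rewrite xE.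
    by rewrite IH ap' (path_sorted sp).
  by left; rewrite sp jx ap' andbT /=; lia.
Qed.

Lemma strict_partitions_uniq j n : (0 < j)%N -> uniq (strict_partitions j n).
Proof.
move=> j0; elim: n => [|n IH] //=; case: ifP => // jn.
rewrite cat_uniq IH map_inj_uniq ?IH ?andbT; last by move=> x y [].
apply/hasPn => p /mapP[p' _ ->]; rewrite /= mem_strict_partitions //=.
by rewrite ltnn !andbF.
Qed.

(** Each [k] in the interval is either absent, contributing 1, or present once, contributing
    [- q ^+ k]. *)
Lemma sum_strict_partitions (K : comPzRingType) (q : K) j n : (0 < j)%N ->
  \sum_(p <- strict_partitions j n) (-1) ^+ size p * q ^+ sumn p =
  \prod_(j <= k < n.+1) (1 - q ^+ k).
Proof.
move=> j0; elim: n => [|n IH] /=.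
  by rewrite big_seq1 mulr1 big_geq.
case: leqP => jn; last by rewrite IH !big_geq //; lia.
rewrite big_cat big_map big_nat_recr //= -IH mulrBr mulr1; congr (_ + _).
rewrite mulr_suml -sumrN; apply: eq_bigr => p _.
by rewrite !exprS exprD; ring.
Qed.

(** * Limits of complex sequences *)

Lemma complex_expr_near0 (R : realType) (x eps : Cplx R) :
  `|x| < 1 -> 0 < eps -> \forall n \near \oo, `|x| ^+ n < eps.
Proof.
have [r r0 ->] : exists2 r : R, 0 <= r & `|x| = (r%:C)%C :> Cplx R.
  by rewrite normc_def; eexists; last reflexivity; exact: sqrtr_ge0.
move=> r1 /[dup] /gtr0_real /RRe_real <-.
rewrite -[1]/((1 : R)%:C%C) -[0]/((0 : R)%:C%C) in r1 *; rewrite !ltcR in r1 *.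
move=> e0; have r1' : `|r| < 1 by rewrite ger0_norm.
have /cvgrPdist_lt /(_ _ e0) := cvg_expr r1'; apply: filterS => n.
by rewrite sub0r normrN ger0_norm ?exprn_ge0 // -rmorphXn /= ltcR.
Qed.

(** With [L = V / (1 - c)], the error [L - u m] is [V - v m] plus [c] times the error at [m - k].
    Along each residue class modulo [k] the error thus contracts by [c], up to a perturbation
    tending to 0. *)
Lemma cvg_shift_recurrence (R : realType) (k : nat) (c V : Cplx R)
    (u v : nat -> Cplx R) :
  (0 < k)%N -> `|c| < 1 ->
  (forall m, u m = v m + (if (k <= m)%N then c * u (m - k)%N else 0)) ->
  v @ \oo --> V -> u @ \oo --> V / (1 - c).
Proof.
move=> k0 c1 uE vV; set L := V / (1 - c).
have c1N0 : 1 - c != 0.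
  by apply/eqP => /eqP; rewrite subr_eq0 => /eqP cE; move: c1; rewrite -cE normr1 ltxx.
have VE : V = L - c * L by rewrite -[X in X - _]mul1r -mulrBl mulrC divfK.
apply/cvgrPdist_lt => eps eps0.
have e2 : 0 < eps / 2 by rewrite divr_gt0.
(* This tolerance for [v] is chosen so that its geometric series in [|c|] sums to [eps / 2]. *)
have d0 : 0 < eps / 2 * (1 - `|c|) by rewrite mulr_gt0 // subr_gt0.
have /cvgrPdist_le /(_ _ d0) [M0 _ vM0] := vV.
pose M := maxn M0 k.
(* [C] dominates the errors on one block of [k] consecutive indices, where the iteration starts. *)
pose C := \sum_(r < k) `|L - u (M + r)%N|.
have C0 : 0 <= C by apply: sumr_ge0.
have bnd t r : (r < k)%N -> `|L - u (M + (t * k + r))%N| <= eps / 2 + C * `|c| ^+ t.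
  move=> rk; elim: t => [|t IH].
    rewrite mul0n add0n expr0 mulr1 -[leLHS]add0r lerD //; first exact: ltW.
    by rewrite /C (bigD1 (Ordinal rk)) //= lerDl sumr_ge0.
  set m := (M + (t.+1 * k + r))%N.
  have km : (k <= m)%N by rewrite /m mulSn; lia.
  have -> : L - u m = (V - v m) + c * (L - u (m - k)%N).
    by rewrite uE km VE; ring.
  have -> : (m - k = M + (t * k + r))%N by rewrite /m mulSn; lia.
  apply: le_trans (ler_normD _ _) _; rewrite normrM.
  have vm : `|V - v m| <= eps / 2 * (1 - `|c|).
    by apply: vM0 => /=; rewrite /m /M; lia.
  apply: le_trans (lerD vm (ler_wpM2l (normr_ge0 c) IH)) _.
  rewrite mulrBr mulr1 mulrDr [ `|c| * (eps / 2)]mulrC addrA subrK.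
  by rewrite exprS mulrCA.
have [T _ hT] : \forall t \near \oo, C * `|c| ^+ t < eps / 2.
  (* [C] may vanish, so the division is by [C + 1]. *)
  have C1 : 0 < C + 1 by rewrite ltr_wpDl.
  have e3 : 0 < eps / 2 / (C + 1) by rewrite divr_gt0.
  have := complex_expr_near0 _ _ _ c1 e3; apply: filterS => t.
  rewrite ltr_pdivlMr // mulrC; apply: le_lt_trans.
  by rewrite ler_wpM2r ?exprn_ge0 // lerDl.
exists (M + T * k)%N => // m /= mM.
have -> : m = (M + ((m - M) %/ k * k + (m - M) %% k))%N.
  by rewrite -divn_eq; lia.
apply: le_lt_trans (bnd _ _ (ltn_pmod _ k0)) _.
rewrite [ltRHS](splitr eps) ltrD2l; apply: hT => /=.
by rewrite leq_divRL //; lia.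
Qed.

Lemma cvg_sum_seq (K : numFieldType) (I : eqType) (r : seq I)
    (f : I -> nat -> K) (l : I -> K) :
  {in r, forall i, f i @ \oo --> l i} ->
  (fun m => \sum_(i <- r) f i m) @ \oo --> \sum_(i <- r) l i.
Proof.
move=> fl; rewrite big_seq.
have -> : (fun m => \sum_(i <- r) f i m) =
          (fun m => \sum_(i <- r | i \in r) f i m).
  by apply/funext => m; rewrite big_seq.
by apply: cvg_big; [exact: add_continuous|exact: fl].
Qed.

Lemma cvg_bounded_partitions (R : realType) (z : Cplx R) (j n : nat) :
  (0 < j)%N -> `|z| < 1 ->
  (fun m => \sum_(p \in bounded_partitions j n m) z ^+ sumn p) @ \oo -->
  \prod_(j <= k < n.+1) (1 - z ^+ k)^-1.
Proof.
move=> j0 z1.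
(* Only the empty partition is left here; this serves both [n = 0] and every [n.+1 < j]. *)
have base n' : (n' < j)%N ->
  (fun m => \sum_(p \in bounded_partitions j n' m) z ^+ sumn p) @ \oo -->
  \prod_(j <= k < n'.+1) (1 - z ^+ k)^-1.
  move=> nj; rewrite big_geq //.
  have -> : (fun m => \sum_(p \in bounded_partitions j n' m) z ^+ sumn p) =
            (fun=> 1).
    by apply/funext => m; rewrite bounded_partitions_nil // fsbig_set1.
  exact: cvg_cst.
elim: n => [|n IH]; first exact: base.
have [jn|/base//] := leqP j n.+1.
rewrite big_nat_recr; last exact: jn.
apply: (@cvg_shift_recurrence _ n.+1 _ _ _ _ _ _ _ IH) => //.
  by rewrite normrX exprn_ilt1 // normr_ge0.
by move=> m; rewrite sum_bounded_partitionsS.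
Qed.

(** * Self-conjugate triples described through their first component *)

Lemma le_smallest_part n p :
  ((n%:Z)%:E <= smallest_part p)%E = all (leq n) p.
Proof.
rewrite /smallest_part; elim: p => [|x p IH]; first by rewrite big_nil leey.
by rewrite big_cons le_min IH /= lee_fin lez_nat.
Qed.

Lemma smallest_part_rcons n p :
  all (leq n) p -> smallest_part (rcons p n) = (n%:Z)%:E.
Proof.
rewrite /smallest_part; elim: p => [|x p IH] /=.
  by rewrite big_seq1.
by case/andP=> nx /IH; rewrite big_cons => ->; apply/min_r; rewrite lee_fin lez_nat.
Qed.

Lemma largest_part_le n p : (largest_part p <= n)%N = all (geq n) p.
Proof.
rewrite /largest_part; elim: p => [|x p IH]; first by rewrite big_nil.
by rewrite big_cons geq_max IH.
Qed.

Lemma sorted_geq_rcons p n :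
  sorted geq (rcons p n) = all (leq n) p && sorted geq p.
Proof. by rewrite !(sorted_pairwise geq_trans) pairwise_rcons. Qed.

(** The last entry [n] of a nonincreasing list is its smallest part. Distinctness pushes the entries
    of [p] up to at least [n.+1], whereas those of [p2] may equal [n]. *)
Lemma S_rconsE N n p p2 :
  S_ N (rcons p n, p2, p2) <->
  [/\ (0 < n <= N)%N, p \in strict_partitions n.+1 N, sorted geq p2
    & all (fun x => n <= x <= N)%N p2].
Proof.
rewrite mem_strict_partitions // gtn_sorted_uniq_geq /S_ /is_partition /=.
rewrite /pi1 /pi2 /pi3 /= !largest_part_le minxx.
split.
- case=> -[/andP[sp1 pos1] /andP[sp2 pos2] _] [_ up1] sm [l1 l2 _].
  move: sp1 pos1 up1 l1; rewrite sorted_geq_rcons !all_rcons rcons_uniq.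
  move=> /andP[np sp] /andP[n0 pos] /andP[nNp up] /andP[nN lp].
  move: sm; rewrite smallest_part_rcons // le_smallest_part => np2.
  split=> //; first by apply/andP.
    rewrite up sp /=; apply/allP => x xp.
    have nx : n != x by apply: contraNneq nNp => ->.
    have := allP np x xp; have := allP lp x xp; rewrite /geq /=; lia.
  by apply/allP => x xp; rewrite (allP np2 x xp); exact: (allP l2 x xp).
- case=> /andP[n0 nN] /andP[/andP[up sp] ap] sp2 ap2.
  have np : all (leq n) p by apply: sub_all ap => x /andP[/ltnW].
  have np2 : all (leq n) p2 by apply: sub_all ap2 => x /andP[].
  have p2E : sorted geq p2 && all (leq 1) p2.
    by rewrite sp2; apply: sub_all np2 => x; exact: leq_trans.
  split.
  + split=> //; rewrite sorted_geq_rcons np sp all_rcons n0 /=.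
    by apply: sub_all np => x; exact: leq_trans.
  + split; first by case: (p).
    rewrite rcons_uniq up andbT; apply/negP => /(allP ap); lia.
  + by rewrite smallest_part_rcons // le_smallest_part.
  + have l2 : all (geq N) p2 by apply: sub_all ap2 => x /andP[].
    split=> //; rewrite all_rcons /= nN.
    by apply: sub_all ap => x /andP[].
Qed.

(** This list does not depend on the weight bound [m], so the outer sum keeps a fixed finite index
    as [m] grows. *)
Definition first_components (N : nat) : seq (seq nat) :=
  [seq rcons p n | n <- index_iota 1 N.+1, p <- strict_partitions n.+1 N].

Lemma first_components_uniq N : uniq (first_components N).
Proof.
apply: allpairs_uniq_dep => /=.
- exact: iota_uniq.
- by move=> n _; exact: strict_partitions_uniq.
- by move=> [n p] [n' p'] _ _ /= /rcons_inj [-> ->].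
Qed.

Definition self_conjugate_triples (N m : nat) : set triple :=
  [set t | [/\ S_ N t, self_conjugate t & (weight t <= m)%N]].

Lemma self_conjugate_triplesP N m t : self_conjugate_triples N m t ->
  exists n p, [/\ (0 < n <= N)%N, p \in strict_partitions n.+1 N,
    t = (rcons p n, pi2 t, pi2 t), sorted geq (pi2 t) &
    all (fun x => n <= x <= N)%N (pi2 t)].
Proof.
case: t => [[p1 p2] p3] [St]; rewrite /self_conjugate /pi2 /pi3 /= => E _.
move: St; rewrite -{}E; case/lastP: p1 => [|p n] St.
  by case: St => _ [].
by exists n, p; case/S_rconsE: St.
Qed.

Lemma pi1_first_components N m t :
  self_conjugate_triples N m t -> pi1 t \in first_components N.
Proof.
case/self_conjugate_triplesP => n [p [nN pN -> _ _]].
by apply/allpairsPdep; exists n, p; rewrite mem_index_iota ltnS.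
Qed.

(** Such a triple is determined by its first two components, and each of these ranges over a finite
    set. *)
Lemma finite_self_conjugate_triples N m :
  finite_set (self_conjugate_triples N m).
Proof.
apply: (@sub_finite_set _ _
  [set (x.1, x.2, x.2) | x in [set` first_components N] `*`
                              bounded_partitions 1 N m]); last first.
  apply: finite_image; apply: finite_setX; first exact: finite_seq.
  exact: finite_bounded_partitions.
move=> t Tt; exists (pi1 t, pi2 t); last first.
  by have [n [p [_ _ -> _ _]]] := self_conjugate_triplesP _ _ _ Tt.
split=> /=; first exact: pi1_first_components Tt.
have [n [p [/andP[n0 _] _ _ sp2 ap2]]] := self_conjugate_triplesP _ _ _ Tt.
split=> //; first by apply: sub_all ap2 => x /andP[nx ->]; rewrite (leq_trans n0).
by case: Tt => _ _; rewrite /weight; lia.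
Qed.

(** * Partial sums of the series and their limits *)

Lemma sum_self_conjugate_triples (K : fieldType) (q : K) N m :
  \sum_(1 <= n < m.+1) (N_SC n N)%:~R * q ^+ n =
  \sum_(t \in self_conjugate_triples N m)
    (-1) ^+ (size (pi1 t)).-1 * q ^+ weight t.
Proof.
have fin := finite_self_conjugate_triples N m.
(* Grouping by weight starts at 1 because the first component has a positive part. *)
rewrite (@fsbig_partition _ _ _ _ weight (index_iota 1 m.+1)) //; first last.
- move=> t Tt; rewrite mem_index_iota ltnS.
  have [n [p [/andP[n0 _] _ tE _ _]]] := self_conjugate_triplesP _ _ _ Tt.
  case: Tt => _ _ ->; rewrite andbT tE /weight /pi1 /= sumn_rcons; lia.
- exact: iota_uniq.
apply: eq_big_nat => n /andP[n0 nm]; rewrite /N_SC.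
have -> : [set t | [/\ S_ N t, self_conjugate t & weight t = n]] =
          [set t | self_conjugate_triples N m t /\ weight t = n].
  apply/seteqP; split=> t; first by move=> [St sc tn]; do !split=> //; rewrite tn.
  by move=> [[]].
have fin' : finite_set [set t | self_conjugate_triples N m t /\ weight t = n].
  by apply: sub_finite_set fin => t [].
rewrite !fsbig_finite //= rmorph_sum mulr_suml; apply: eq_big_seq => t.
rewrite in_fset_set // inE => -[_ <-].
by rewrite rmorphXn rmorphN1.
Qed.

(** The weight is [sumn p + n] plus twice [sumn p2], which explains the halved bound and the base
    [q ^+ 2]. If [m] were below [sumn p + n], the left side would be empty but the right side would
    still count the empty [p2]. *)
Lemma sum_self_conjugate_section (K : fieldType) (q : K) N m n p :
  (0 < n <= N)%N -> p \in strict_partitions n.+1 N -> (sumn p + n <= m)%N ->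
  \sum_(t \in [set t | self_conjugate_triples N m t /\ pi1 t = rcons p n])
    (-1) ^+ (size (pi1 t)).-1 * q ^+ weight t =
  (-1) ^+ size p * q ^+ (sumn p + n) *
  \sum_(p2 \in bounded_partitions n N ((m - (sumn p + n))./2))
    (q ^+ 2) ^+ sumn p2.
Proof.
move=> nN pN pm.
rewrite (@reindex_fsbig _ _ _ _ _ (fun p2 => (rcons p n, p2, p2))
  (bounded_partitions n N ((m - (sumn p + n))./2))); last first.
  split.
  - move=> p2 [sp2 ap2 w]; split=> //; split=> //; first exact/S_rconsE.
    by rewrite /weight /pi1 /pi2 /pi3 /= sumn_rcons; lia.
  - by move=> x y _ _ [].
  - move=> [[p1 p2] p3] [[St]]; rewrite /self_conjugate /weight /pi1 /pi2 /pi3 /=.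
    move=> E w p1E; move: St w; rewrite -{}E {}p1E => /S_rconsE[_ _ sp2 ap2].
    by rewrite sumn_rcons => w; exists p2 => //; split=> //; lia.
rewrite mulr_fsumr; apply: eq_fsbigr => p2 _.
rewrite /weight /pi1 /pi2 /pi3 /= size_rcons sumn_rcons -mulrA -exprM -exprD.
by congr (_ * _ ^+ _); lia.
Qed.

Lemma cvg_self_conjugate_section (R : realType) (q : Cplx R) N n p :
  `|q| < 1 -> (0 < n <= N)%N -> p \in strict_partitions n.+1 N ->
  (fun m => \sum_(t \in [set t | self_conjugate_triples N m t
                                /\ pi1 t = rcons p n])
     (-1) ^+ (size (pi1 t)).-1 * q ^+ weight t) @ \oo -->
  (-1) ^+ size p * q ^+ (sumn p + n) *
  \prod_(n <= k < N.+1) (1 - (q ^+ 2) ^+ k)^-1.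
Proof.
move=> q1 nN pN.
have half_oo : (fun m => (m - (sumn p + n))./2) @ \oo --> \oo.
  apply/cvgnyPge => A; exists (A.*2 + (sumn p + n))%N => // m /=; lia.
have q2 : `|q ^+ 2| < 1 by rewrite normrX exprn_ilt1 // normr_ge0.
have n0 : (0 < n)%N by case/andP: nN.
have lim : (fun m => (-1) ^+ size p * q ^+ (sumn p + n) *
    \sum_(p2 \in bounded_partitions n N ((m - (sumn p + n))./2))
      (q ^+ 2) ^+ sumn p2) @ \oo -->
  (-1) ^+ size p * q ^+ (sumn p + n) *
  \prod_(n <= k < N.+1) (1 - (q ^+ 2) ^+ k)^-1.
  apply: cvgM; first exact: cvg_cst.
  exact: (cvg_comp _ _ half_oo (cvg_bounded_partitions _ _ _ N n0 q2)).
(* The closed form of the section holds only from [m = sumn p + n] on, which suffices for the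
   limit. *)
apply: cvg_trans lim; apply: near_eq_cvg.
exists (sumn p + n)%N => // m /= pm.
by rewrite sum_self_conjugate_section.
Qed.

Theorem theorem6p2 (R : realType) (N : nat) (q : Cplx R) (hq : `|q| < 1) :
  (fun m : nat => \sum_(1 <= n < m.+1) (N_SC n N)%:~R * q ^+ n) @ \oo -->
  \sum_(1 <= n < N.+1)
    q ^+ n * qpoch (q ^+ n.+1) q (N - n)
      / qpoch (q ^+ (2 * n)) (q ^+ 2) (N - n + 1).
Proof.
have -> : (fun m : nat => \sum_(1 <= n < m.+1) (N_SC n N)%:~R * q ^+ n) =
  (fun m => \sum_(1 <= n < N.+1) \sum_(p <- strict_partitions n.+1 N)
     \sum_(t \in [set t | self_conjugate_triples N m t /\ pi1 t = rcons p n])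
       (-1) ^+ (size (pi1 t)).-1 * q ^+ weight t).
  apply/funext => m; rewrite sum_self_conjugate_triples.
  (* Grouping by [pi1] turns the partial sum into a fixed finite sum of sections, whose limits can
     be taken one by one. *)
  rewrite (@fsbig_partition _ _ _ _ pi1 (first_components N)).
  - by rewrite big_allpairs_dep.
  - exact: finite_self_conjugate_triples.
  - exact: first_components_uniq.
  - exact: pi1_first_components.
apply: cvg_sum_seq => n; rewrite mem_index_iota ltnS => nN.
have -> : q ^+ n * qpoch (q ^+ n.+1) q (N - n)
      / qpoch (q ^+ (2 * n)) (q ^+ 2) (N - n + 1) =
  \sum_(p <- strict_partitions n.+1 N) (-1) ^+ size p * q ^+ (sumn p + n) *
    \prod_(n <= k < N.+1) (1 - (q ^+ 2) ^+ k)^-1.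
  rewrite -mulr_suml; congr (_ * _).
    under eq_bigr do rewrite exprD mulrA.
    rewrite -mulr_suml sum_strict_partitions // mulrC; congr (_ * _).
    (* Shifting the index by [n.+1] identifies the [N - n] factors with those for [k] from [n.+1] to
       [N]. *)
    rewrite /qpoch -(big_mkord xpredT (fun k => 1 - q ^+ n.+1 * q ^+ k)).
    rewrite -[in RHS](add0n n.+1) big_addn subSS; apply: eq_bigr => k _.
    by rewrite -exprD addnC.
  rewrite /qpoch -prodfV.
  (* Here the range starts at [n] itself, which gives one factor more. *)
  rewrite -(big_mkord xpredT (fun k => (1 - q ^+ (2 * n) * (q ^+ 2) ^+ k)^-1)).
  rewrite -[in RHS](add0n n) big_addn subSn ?addn1; last by case/andP: nN.
  by apply: eq_bigr => k _; rewrite exprM -exprD addnC.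
by apply: cvg_sum_seq => p pN; exact: cvg_self_conjugate_section.
Qed.
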